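(* Suppose that $K$ is a commutative associative algebra over $F$ and that the triple $(T,N_+,N_-)$, defined on a pair of $K$-modules $(\mathcal{V}_+,\mathcal{V}_-)$, has an adjoint. Let $\mathcal{E}=K\oplus K$ with the exchange involution $*$ and let $\mathcal{W}=\mathcal{V}_+\oplus\mathcal{V}_-$. For $\alpha=(\alpha_+,\alpha_-)\in\mathcal{E}$ and $v=(v_+,v_-),u=(u_+,u_-)\in\mathcal{W}$, set $\alpha v=(\alpha_+v_+,\alpha_-v_-)$, $$N(v)=(N_+(v_+),N_-(v_-))\quad\text{and}\quad h(v,u)=(T(v_+,u_-),T(v_-,u_+)).$$ Then: (a) $\mathcal{W}$ is a left $\mathcal{E}$-module, $N$ is a cubic form over $\mathcal{E}$, $h$ is a nondegenerate hermitian form, $(h,N)$ has an adjoint, and $\mathcal{M}(T,N_+,N_-)\simeq\mathcal{A}(h,N)$ as algebras with involution. (b) If $(T,N_+,N_-)$ satisfies the adjoint identity, then so does $(h,N)$. (c) If $(T,N_+,N_-)$ satisfies the adjoint identity, then $\mathcal{M}(T,N_+,N_-)$ is a structurable algebra with centre $K1$.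
   Context: $F$ is a field of characteristic $\ne 2,3$. ''Algebra'' means unital, not necessarily associative $F$-algebra; $[x,y]=xy-yx$, $(x,y,z)=(xy)z-x(yz)$. An algebra with involution is an algebra with an anti-automorphism $*$ of period 2; $\mathcal{A}_+=\{x:x^*=x\}$; its centre is $\{z\in\mathcal{A}_+:[z,\mathcal{A}]=(z,\mathcal{A},\mathcal{A})=(\mathcal{A},z,\mathcal{A})=(\mathcal{A},\mathcal{A},z)=0\}$. A structurable algebra is an algebra with involution satisfying $\{xy\{zwq\}\}-\{zw\{xyq\}\}=\{\{xyz\}wq\}-\{z\{yxw\}q\}$, where $\{xyz\}=(xy^* )z+(zy^* )x-(zx^* )y$. Let $\mathcal{E}$ be a commutative associative algebra with involution $*$ and $\mathcal{W}$ a left $\mathcal{E}$-module. A cubic form $N:\mathcal{W}\to\mathcal{E}$ over $\mathcal{E}$ is a map $N(x)=\frac16f(x,x,x)$ with $f:\mathcal{W}^3\to\mathcal{E}$ symmetric and $\mathcal{E}$-trilinear; $\partial_uN|_v=\frac12f(u,v,v)$. A hermitian form is a biadditive $h:\mathcal{W}\times\mathcal{W}\to\mathcal{E}$ with $h(au,v)=ah(u,v)$, $h(u,av)=a^*h(u,v)$, $h(v,u)=h(u,v)^*$; nondegenerate: $h(\mathcal{W},u)=0$ implies $u=0$. For $h$ nondegenerate, $(h,N)$ has an adjoint if for each $v$ there is $v^\natural\in\mathcal{W}$ with $\partial_uN|_v=h(u,v^\natural)$ for all $u$; then $u\diamond v:=(u+v)^\natural-u^\natural-v^\natural$. $(h,N)$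 satisfies the adjoint identity if it has an adjoint and $(v^\natural)^\natural=N(v)v$ for all $v$. When $(h,N)$ has an adjoint, $\mathcal{A}(h,N)=\mathcal{E}\oplus\mathcal{W}$ is the algebra with involution with $(a,v)(b,w)=(ab+h(v,w),\,aw+b^*v+v\diamond w)$, $(a,v)^*=(a^*,v)$. Pair version. Let $K$ be a commutative associative $F$-algebra, $(\mathcal{V}_+,\mathcal{V}_-)$ a pair of $K$-modules, $N_\sigma:\mathcal{V}_\sigma\to K$ ($\sigma=\pm$) cubic forms over $K$, and $T:\mathcal{V}_+\times\mathcal{V}_-\to K$ a $K$-bilinear pairing that is nondegenerate ($T(v_+,\mathcal{V}_-)=0\Rightarrow v_+=0$ and $T(\mathcal{V}_+,v_-)=0\Rightarrow v_-=0$); put $T(v_-,v_+)=T(v_+,v_-)$. $(T,N_+,N_-)$ has an adjoint if for $\sigma=\pm$ and each $u\in\mathcal{V}_\sigma$ there is $u^\#\in\mathcal{V}_{-\sigma}$ (necessarily unique) with $\partial_vN_\sigma|_u=T(v,u^\#)$ for all $v\in\mathcal{V}_\sigma$; then $u\times v=(u+v)^\#-u^\#-v^\#$ for $u,v\in\mathcal{V}_\sigma$. It satisfies the adjoint identity if moreover $(v^\#)^\#=N_\sigma(v)v$ for all $v\in\mathcal{V}_\sigma$, $\sigma=\pm$. When $(T,N_+,N_-)$ has an adjoint, $\mathcal{M}(T,N_+,N_-)$ is the algebra with involution of all matrices $\begin{bmatrix} \alpha_+ & v_+ \\ v_- & \alpha_- \end{bmatrix}$, $\alpha_\sigma\in K$,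 $v_\sigma\in\mathcal{V}_\sigma$, with $$\begin{bmatrix} \alpha_+ & v_+ \\ v_- & \alpha_- \end{bmatrix}\begin{bmatrix} \beta_+ & u_+ \\ u_- & \beta_- \end{bmatrix}=\begin{bmatrix} \alpha_+\beta_+ + T(v_+,u_-) & \alpha_+u_+ + \beta_-v_+ + v_-\times u_- \\ \beta_+v_- + \alpha_-u_- + v_+\times u_+ & \alpha_-\beta_- + T(v_-,u_+) \end{bmatrix}$$ and $\begin{bmatrix} \alpha_+ & v_+ \\ v_- & \alpha_- \end{bmatrix}^*=\begin{bmatrix} \alpha_- & v_+ \\ v_- & \alpha_+ \end{bmatrix}$. *)

(* Defs.v *)
From HB Require Import structures.
From mathcomp Require Import all_boot all_algebra.
From mathcomp Require Import boolp classical_sets.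

Set Implicit Arguments.
Unset Strict Implicit.
Unset Printing Implicit Defensive.

Import GRing.Theory.
Local Open Scope ring_scope.

(* A commutative associative F-algebra is given by a commutative ring E and its
   structure map iota : F -> E.  Unlike comAlgType F, this does not exclude the
   zero algebra.  E-modules are F-modules through iota. *)

Section RestrictionOfScalars.
Variables (F E : pzRingType) (iota : {rmorphism F -> E}) (V : lmodType E).

Definition restr_scalars & {rmorphism F -> E} : Type := V.

HB.instance Definition _ := GRing.Zmodule.on (restr_scalars iota).

Definition rscale (c : F) (v : restr_scalars iota) : restr_scalars iota :=
  iota c *: (v : V).

Fact rscaleA a b v : rscale a (rscale b v) = rscale (a * b) v.
Proof. by rewrite /rscale scalerA rmorphM. Qed.
Fact rscale1 : left_id 1 rscale.
Proof. by move=> v; rewrite /rscale rmorph1 scale1r. Qed.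
Fact rscaleDr : right_distributive rscale +%R.
Proof. by move=> a u v; rewrite /rscale scalerDr. Qed.
Fact rscaleDl v : {morph rscale^~ v : a b / a + b}.
Proof. by move=> a b; rewrite /rscale rmorphD scalerDl. Qed.

HB.instance Definition _ := GRing.Zmodule_isLmodule.Build F (restr_scalars iota)
  rscaleA rscale1 rscaleDr rscaleDl.

End RestrictionOfScalars.

Arguments restr_scalars {F E} V iota.

Section AlgebrasWithInvolution.
Variable F : fieldType.

(* Operations only; the axioms are in [is_invalg].  Not necessarily
   associative, hence not an instance of the library's ring structures. *)
Record invalg_ops := InvalgOps {
  invalg_sort :> lmodType F;
  amul : invalg_sort -> invalg_sort -> invalg_sort;
  aone : invalg_sort;
  astar : invalg_sort -> invalg_sort }.

Definition is_invalg (A : invalg_ops) : Prop :=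
  [/\ (forall y : A, linear (fun x : A => amul x y))
        /\ (forall x : A, linear (fun y : A => amul x y)),
      left_id (aone A) (@amul A) /\ right_id (aone A) (@amul A),
      linear (@astar A),
      (forall x y : A, astar (amul x y) = amul (astar y) (astar x))
    & involutive (@astar A)].

Definition invalg_iso (A B : invalg_ops) : Prop :=
  exists phi : A -> B,
    [/\ linear phi, bijective phi,
        (forall x y, phi (amul x y) = amul (phi x) (phi y)),
        phi (aone A) = aone B
      & forall x, phi (astar x) = astar (phi x)].

Definition alg_commutator (A : invalg_ops) (x y : A) : A := amul x y - amul y x.

Definition alg_associator (A : invalg_ops) (x y z : A) : A :=
  amul (amul x y) z - amul x (amul y z).

Definition in_centre (A : invalg_ops) (z : A) : Prop :=
  astar z = z /\
  forall x y : A, [/\ alg_commutator z x = 0, alg_associator z x y = 0,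
                      alg_associator x z y = 0 & alg_associator x y z = 0].

Definition alg_triple (A : invalg_ops) (x y z : A) : A :=
  amul (amul x (astar y)) z + amul (amul z (astar y)) x
  - amul (amul z (astar x)) y.

Definition structurable (A : invalg_ops) : Prop :=
  is_invalg A /\
  forall x y z w q : A,
    alg_triple x y (alg_triple z w q) - alg_triple z w (alg_triple x y q) =
    alg_triple (alg_triple x y z) w q - alg_triple z (alg_triple y x w) q.

End AlgebrasWithInvolution.

Definition is_left_module (E : pzRingType) (W : zmodType) (s : E -> W -> W)
    : Prop :=
  [/\ (forall a b v, s a (s b v) = s (a * b) v), left_id 1 s,
      (forall a, {morph s a : u v / u + v})
    & forall v, {morph s^~ v : a b / a + b}].

Section CubicForms.
Variables (F : fieldType) (E : comPzRingType) (iota : {rmorphism F -> E}).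
Variable W : lmodType E.

Definition symmetric_trilinear (f : W -> W -> W -> E) : Prop :=
  [/\ (forall x y z, f x y z = f y x z), (forall x y z, f x y z = f x z y),
      (forall y z, scalar (fun x => f x y z)),
      (forall x z, scalar (fun y => f x y z))
    & (forall x y, scalar (fun z => f x y z))].

Definition linearization (N : W -> E) (f : W -> W -> W -> E) : Prop :=
  symmetric_trilinear f /\ forall x, N x = iota 6%:R^-1 * f x x x.

Definition cubic_form (N : W -> E) : Prop := exists f, linearization N f.

(* The derivative (d_u N)(v) = f(u,v,v)/2; the linearization f of a cubic form
   is unique when 6 is invertible in F, so this is a definite description. *)
Definition cubic_deriv (N : W -> E) (u v : W) : E :=
  xget 0 (fun e => exists2 f, linearization N f & e = iota 2%:R^-1 * f u v v).

(* W' = W and T = h for hermitian forms; W, W' = V_s, V_{-s} and T the pairing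
   in the pair version. *)
Variables (W' : lmodType E) (T : W -> W' -> E) (N : W -> E).

Definition is_adjoint (v : W) (w : W') : Prop :=
  forall u, cubic_deriv N u v = T u w.

Definition has_adjoint : Prop := forall v, exists w, is_adjoint v w.

(* Unique, when it exists, if T is nondegenerate on the right. *)
Definition adjoint (v : W) : W' := xget 0 (is_adjoint v).

Definition adj_prod (u v : W) : W' :=
  adjoint (u + v) - adjoint u - adjoint v.

End CubicForms.

Section HermitianForms.
Variables (F : fieldType) (E : comPzRingType) (iota : {rmorphism F -> E}).
Variables (star : E -> E) (W : lmodType E) (h : W -> W -> E) (N : W -> E).

Definition hermitian_form : Prop :=
  [/\ (forall v, {morph h^~ v : u w / u + w}),
      (forall u, {morph h u : v w / v + w}),
      (forall a u v, h (a *: u) v = a * h u v),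
      (forall a u v, h u (a *: v) = star a * h u v)
    & forall u v, h v u = star (h u v)].

Definition nondegenerate_form : Prop :=
  forall u, (forall w, h w u = 0) -> u = 0.

Definition adjoint_identity : Prop :=
  has_adjoint iota h N /\
  forall v, adjoint iota h N (adjoint iota h N v) = N v *: v.

Definition cA_carrier : lmodType F := restr_scalars (E^o * W)%type iota.

Definition cA_mul (x y : cA_carrier) : cA_carrier :=
  let: (a, v) := x in let: (b, w) := y in
  (a * b + h v w, a *: w + star b *: v + adj_prod iota h N v w).

Definition cA_one : cA_carrier := (1, 0).

Definition cA_star (x : cA_carrier) : cA_carrier :=
  let: (a, v) := x in (star a, v).

Definition cA : invalg_ops F := InvalgOps cA_mul cA_one cA_star.

End HermitianForms.

Section Pairs.
Variables (F : fieldType) (K : comPzRingType) (iota : {rmorphism F -> K}).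
Variables (Vp Vm : lmodType K) (T : Vp -> Vm -> K).
Variables (Np : Vp -> K) (Nm : Vm -> K).

Definition bilinear_pairing : Prop :=
  (forall vm, scalar (T^~ vm)) /\ (forall vp, scalar (T vp)).

Definition nondegenerate_pairing : Prop :=
  (forall vp, (forall vm, T vp vm = 0) -> vp = 0) /\
  (forall vm, (forall vp, T vp vm = 0) -> vm = 0).

Definition Tr (vm : Vm) (vp : Vp) : K := T vp vm.

Definition pair_has_adjoint : Prop :=
  has_adjoint iota T Np /\ has_adjoint iota Tr Nm.

Definition pair_adjoint_identity : Prop :=
  [/\ pair_has_adjoint,
      (forall v, adjoint iota Tr Nm (adjoint iota T Np v) = Np v *: v)
    & (forall v, adjoint iota T Np (adjoint iota Tr Nm v) = Nm v *: v)].

(* (ap, vp, vm, am) is the matrix with rows (ap, vp) and (vm, am). *)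
Definition cM_Kmod : lmodType K := (K^o * Vp * Vm * K^o)%type.

Definition cM_carrier : lmodType F := restr_scalars cM_Kmod iota.

Definition cM_mul (x y : cM_carrier) : cM_carrier :=
  let: (ap, vp, vm, am) := x in let: (bp, up, um, bm) := y in
  (ap * bp + T vp um,
   ap *: up + bm *: vp + adj_prod iota Tr Nm vm um,
   bp *: vm + am *: um + adj_prod iota T Np vp up,
   am * bm + Tr vm up).

Definition cM_one : cM_Kmod := (1, 0, 0, 1).

Definition cM_star (x : cM_carrier) : cM_carrier :=
  let: (ap, vp, vm, am) := x in (am, vp, vm, ap).

Definition cM : invalg_ops F := InvalgOps cM_mul (cM_one : cM_carrier) cM_star.

End Pairs.

Section ExchangeAlgebra.
Variables (F : fieldType) (K : comPzRingType) (iota : {rmorphism F -> K}).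

Definition exchange (a : K * K) : K * K := (a.2, a.1).

Definition iota2 (c : F) : K * K := (iota c, iota c).

Fact iota2_zmod_morphism : zmod_morphism iota2.
Proof. by move=> a b; rewrite /iota2 rmorphB. Qed.
Fact iota2_monoid_morphism : monoid_morphism iota2.
Proof. by split=> [|a b]; rewrite /iota2 ?rmorph1 ?rmorphM. Qed.

HB.instance Definition _ :=
  GRing.isZmodMorphism.Build F (K * K)%type iota2 iota2_zmod_morphism.
HB.instance Definition _ :=
  GRing.isMonoidMorphism.Build F (K * K)%type iota2 iota2_monoid_morphism.

Variables (Vp Vm : lmodType K).

Definition exch_scale (a : K * K) (v : Vp * Vm) : Vp * Vm :=
  (a.1 *: v.1, a.2 *: v.2).

Fact exch_scaleA a b v : exch_scale a (exch_scale b v) = exch_scale (a * b) v.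
Proof. by rewrite /exch_scale /= !scalerA. Qed.
Fact exch_scale1 : left_id 1 exch_scale.
Proof. by case=> v w; rewrite /exch_scale /= !scale1r. Qed.
Fact exch_scaleDr : right_distributive exch_scale +%R.
Proof. by move=> a u v; rewrite /exch_scale /= !scalerDr. Qed.
Fact exch_scaleDl v : {morph exch_scale^~ v : a b / a + b}.
Proof. by move=> a b; rewrite /exch_scale /= !scalerDl. Qed.

(* An alias of Vp * Vm, to carry the (K * K)-module structure beside the
   library's K-module structure on Vp * Vm. *)
Definition exch_mod : Type := (Vp * Vm)%type.

HB.instance Definition _ := GRing.Zmodule.on exch_mod.
HB.instance Definition _ :=
  GRing.Zmodule_isLmodule.Build (K * K)%type exch_mod
    exch_scaleA exch_scale1 exch_scaleDr exch_scaleDl.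

Variables (T : Vp -> Vm -> K) (Np : Vp -> K) (Nm : Vm -> K).

Definition exch_N (v : exch_mod) : K * K := (Np v.1, Nm v.2).

Definition exch_h (v u : exch_mod) : K * K := (T v.1 u.2, Tr T v.2 u.1).

End ExchangeAlgebra.

(* Main.v *)
(* With x = (a, b, c, d) written in the order (alpha_+, v_+, v_-, alpha_-), let
    X_v and Y_u be the degree 2 and degree -2 operators of the grading in which
    alpha_+, V_-, V_+, alpha_- have degrees 3, 1, -1, -3, namely
      X_v (a, b, c, d) = (T(v, c), d v, v \times b, 0),
      Y_u (a, b, c, d) = (0, u \times c, a u, T(b, u)).
    Every operator V_{x,y} : z |-> {x y z} is a combination of some X_p, Y_q, of
    commutators [X_v, Y_u] and of two diagonal operators.  Hence the
    structurable identity, which says that (V_{x,y}, -V_{y,x}) is a derivation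
    of the triple product (in the sense of triple systems with two kinds of
    variables), reduces to the same assertion for (X_v, -X_v), for (Y_u, -Y_u)
    and for the diagonal operators.  For X_v it follows from the full
    linearization of the adjoint identity (v^#)^# = N(v) v, and Y_u is obtained
    by exchanging V_+ and V_-. *)

Require Import Defs.
From HB Require Import structures.
From mathcomp Require Import all_boot all_algebra ring.
From mathcomp Require Import boolp classical_sets.

Set Implicit Arguments.
Unset Strict Implicit.
Unset Printing Implicit Defensive.

Import GRing.Theory.
Local Open Scope ring_scope.

(** * Rules for functions known only to satisfy [linear] or [scalar] *)

Lemma linear_rules (K : pzRingType) (U V : lmodType K) (f : U -> V) :
  linear f ->
  [/\ f 0 = 0, (forall u v, f (u + v) = f u + f v),
      (forall u, f (- u) = - f u) & (forall a u, f (a *: u) = a *: f u)].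
Proof.
move=> lin.
have f0 : f 0 = 0.
  have := lin 1 0 0; rewrite scaler0 add0r scale1r => e.
  by apply: (addrI (f 0)); rewrite addr0 -e.
have fD u v : f (u + v) = f u + f v.
  by rewrite -[u in LHS]scale1r lin scale1r.
have fZ a u : f (a *: u) = a *: f u.
  by rewrite -[a *: u]addr0 lin f0 addr0.
by split=> // u; rewrite -scaleN1r fZ scaleN1r.
Qed.

Lemma scalar_rules (K : pzRingType) (V : lmodType K) (phi : V -> K) :
  scalar phi ->
  [/\ phi 0 = 0, (forall u v, phi (u + v) = phi u + phi v),
      (forall u, phi (- u) = - phi u) & (forall a u, phi (a *: u) = a * phi u)].
Proof. exact: (@linear_rules K V K^o). Qed.

Lemma scale_regE (K : pzRingType) (a b : K) : a *: (b : K^o) = a * b.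
Proof. by []. Qed.

(** * Paired modules with symmetric products dual to cubic forms *)

Section CubicPairing.
Variables (K : comPzRingType) (Vp Vm : lmodType K) (T : Vp -> Vm -> K).
Variables (cp : Vp -> Vp -> Vm) (cm : Vm -> Vm -> Vp).

(* [cp] and [cm] stand for the products u \times v on V_+ and V_-; with f(u, v, w) = T(u, v \times w),
   the last four fields say that both f are symmetric. *)
Record cubic_pairing : Prop := CubicPairing {
  cpair_bilinear : bilinear_pairing T;
  cpair_nondeg : nondegenerate_pairing T;
  cpair_cpC : forall u v, cp u v = cp v u;
  cpair_cmC : forall u v, cm u v = cm v u;
  cpair_Tcp : forall u v w, T u (cp v w) = T v (cp u w);
  cpair_Tcm : forall u v w, T (cm v w) u = T (cm u w) v }.

(* The full linearization of (v^#)^# = N(v) v on V_+. *)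
Definition lin_adjoint_identity : Prop := forall a b c d,
  cm (cp a b) (cp c d) + cm (cp a c) (cp b d) + cm (cp a d) (cp b c) =
  T b (cp c d) *: a + T a (cp c d) *: b + T a (cp b d) *: c
  + T a (cp b c) *: d.

End CubicPairing.

(** The axioms are symmetric under exchange of [Vp] and [Vm]: the last two fields trade places up to
    conversion. Each rule for [cp] thus gives one for [cm]. *)
Lemma cubic_pairing_swap (K : comPzRingType) (Vp Vm : lmodType K)
    (T : Vp -> Vm -> K) (cp : Vp -> Vp -> Vm) (cm : Vm -> Vm -> Vp) :
  cubic_pairing T cp cm -> cubic_pairing (Tr T) cm cp.
Proof. by case=> -[Tl Tr_] [ndl ndr] cpC cmC Tcp Tcm. Qed.

Section CubicPairingTheory.
Variables (K : comPzRingType) (Vp Vm : lmodType K) (T : Vp -> Vm -> K).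
Variables (cp : Vp -> Vp -> Vm) (cm : Vm -> Vm -> Vp).
Variable P : cubic_pairing T cp cm.

Lemma pairing0l w : T 0 w = 0.
Proof. by case: (scalar_rules ((cpair_bilinear P).1 w)). Qed.
Lemma pairingDl u v w : T (u + v) w = T u w + T v w.
Proof. by case: (scalar_rules ((cpair_bilinear P).1 w)). Qed.
Lemma pairingNl u w : T (- u) w = - T u w.
Proof. by case: (scalar_rules ((cpair_bilinear P).1 w)). Qed.
Lemma pairingZl a u w : T (a *: u) w = a * T u w.
Proof. by case: (scalar_rules ((cpair_bilinear P).1 w)). Qed.
Lemma pairing0r u : T u 0 = 0.
Proof. by case: (scalar_rules ((cpair_bilinear P).2 u)). Qed.
Lemma pairingDr u v w : T u (v + w) = T u v + T u w.
Proof. by case: (scalar_rules ((cpair_bilinear P).2 u)). Qed.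
Lemma pairingNr u w : T u (- w) = - T u w.
Proof. by case: (scalar_rules ((cpair_bilinear P).2 u)). Qed.
Lemma pairingZr a u w : T u (a *: w) = a * T u w.
Proof. by case: (scalar_rules ((cpair_bilinear P).2 u)). Qed.

Lemma pairing_injl u v : (forall w, T u w = T v w) -> u = v.
Proof.
move=> e; apply/subr0_eq/(cpair_nondeg P).1 => w.
by rewrite pairingDl pairingNl e subrr.
Qed.
Lemma pairing_injr u v : (forall w, T w u = T w v) -> u = v.
Proof.
move=> e; apply/subr0_eq/(cpair_nondeg P).2 => w.
by rewrite pairingDr pairingNr e subrr.
Qed.

(** [cubic_pairing] does not assume that [cp] is bilinear. This follows since [cpair_Tcp] moves the
    first factor into the left slot of [T], and nondegeneracy separates the points of [Vm]. *)
Lemma cp0l v : cp 0 v = 0.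
Proof. by apply: pairing_injr=> w; rewrite (cpair_Tcp P) pairing0l pairing0r. Qed.
Lemma cpDl u v w : cp (u + v) w = cp u w + cp v w.
Proof.
apply: pairing_injr=> z.
by rewrite pairingDr ![T z _](cpair_Tcp P) pairingDl.
Qed.
Lemma cpNl u w : cp (- u) w = - cp u w.
Proof.
by apply: pairing_injr=> z; rewrite pairingNr ![T z _](cpair_Tcp P) pairingNl.
Qed.
Lemma cpZl a u w : cp (a *: u) w = a *: cp u w.
Proof.
by apply: pairing_injr=> z; rewrite pairingZr ![T z _](cpair_Tcp P) pairingZl.
Qed.
Lemma cp0r v : cp v 0 = 0. Proof. by rewrite (cpair_cpC P) cp0l. Qed.
Lemma cpDr u v w : cp u (v + w) = cp u v + cp u w.
Proof. by rewrite !(cpair_cpC P u) cpDl. Qed.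
Lemma cpNr u w : cp u (- w) = - cp u w.
Proof. by rewrite !(cpair_cpC P u) cpNl. Qed.
Lemma cpZr a u w : cp u (a *: w) = a *: cp u w.
Proof. by rewrite !(cpair_cpC P u) cpZl. Qed.

Definition cpE := (cp0l, cp0r, cpDl, cpDr, cpNl, cpNr, cpZl, cpZr).
Definition pairingE := (pairing0l, pairing0r, pairingDl, pairingDr, pairingNl,
  pairingNr, pairingZl, pairingZr).

Lemma pairing_crosscross a b u v : T a (cp b (cm u v)) = T (cm u v) (cp a b).
Proof. by rewrite (cpair_cpC P b) (cpair_Tcp P). Qed.

End CubicPairingTheory.

(** * The triple product on matrices and its graded operators *)

Section Operators.
Variables (K : comPzRingType) (Vp Vm : lmodType K) (T : Vp -> Vm -> K).
Variables (cp : Vp -> Vp -> Vm) (cm : Vm -> Vm -> Vp).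

(** This is the matrix space over K, before restriction of scalars to F. For [cp] and [cm] the
    products of the two cubic forms, [qmul] and [qstar] are convertible to the operations of
    [cM]. *)
Definition quad : lmodType K := (K^o * Vp * Vm * K^o)%type.

Definition qmul (x y : quad) : quad :=
  let: (ap, vp, vm, am) := x in let: (bp, up, um, bm) := y in
  (ap * bp + T vp um, ap *: up + bm *: vp + cm vm um,
   bp *: vm + am *: um + cp vp up, am * bm + Tr T vm up).

Definition qstar (x : quad) : quad :=
  let: (ap, vp, vm, am) := x in (am, vp, vm, ap).

Definition qtriple (x y z : quad) : quad :=
  qmul (qmul x (qstar y)) z + qmul (qmul z (qstar y)) x
  - qmul (qmul z (qstar x)) y.

Definition up_op (v : Vp) (z : quad) : quad :=
  let: (ap, vp, vm, am) := z in (T v vm, am *: v, cp v vp, 0).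
Definition down_op (u : Vm) (z : quad) : quad :=
  let: (ap, vp, vm, am) := z in (0, cm u vm, ap *: u, T vp u).
(** With x = (1, 0, 0, 0) and y = (0, 0, 0, 1), [grade_op] is V_{x,y} and [cograde_op] is V_{y,x}.
    Their sum is the identity; their difference is diag(3, -1, 1, -3), the operator that multiplies
    by the degree. *)
Definition grade_op (z : quad) : quad :=
  let: (ap, vp, vm, am) := z in (2 * ap, 0, vm, - am).
Definition cograde_op (z : quad) : quad :=
  let: (ap, vp, vm, am) := z in (- ap, vp, 0, 2 * am).
Definition updown_op v u z := up_op v (down_op u z) - down_op u (up_op v z).

Variable P : cubic_pairing T cp cm.
Local Notation P' := (cubic_pairing_swap P).

(* Testing on functionals turns identities in the modules into identities in K,
   where [ring] applies. *)
Lemma quad_sep (x y : quad) :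
  (forall phi : quad -> K, scalar phi -> phi x = phi y) -> x = y.
Proof.
move: x y => [[[a b] c] d] [[[a' b'] c'] d'] e.
have ea := e (fun z => z.1.1.1) (fun k u v => erefl).
have ed := e (fun z => z.2) (fun k u v => erefl).
have eb : b = b'.
  apply: (pairing_injl P) => w; apply: (e (fun z => T z.1.1.2 w)) => k u v.
  by rewrite /= (pairingDl P) (pairingZl P).
have ec : c = c'.
  apply: (pairing_injr P) => w; apply: (e (fun z => T w z.1.2)) => k u v.
  by rewrite /= (pairingDr P) (pairingZr P).
by rewrite /= in ea ed; rewrite ea eb ec ed.
Qed.

Local Notation qE := (cpE P, cpE P', pairingE P).

(** The decomposition of V_{x,y} on which the reduction rests. It is checked by coordinates, the
    module ones after pairing with an arbitrary [w]. *)
Lemma qtripleE a b c d a' b' c' d' (z : quad) :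
  qtriple (a, b, c, d) (a', b', c', d') z =
  up_op (a *: b' + a' *: b + cm c c') z
  + down_op (d *: c' + d' *: c + cp b b') z
  + (a * d' + T b' c) *: grade_op z + (d * a' + T b c') *: cograde_op z
  - updown_op b' c z + updown_op b c' z.
Proof.
move: z => [[[k l] m] n].
rewrite /updown_op /up_op /down_op /grade_op /cograde_op /qtriple /= /Tr.
have cpC := cpair_cpC P; have cmC := cpair_cmC P.
congr (_, _, _, _); rewrite /= ?qE ?scale_regE.
- rewrite (cpair_Tcm P c m) (cpair_Tcm P c' m) (cmC c').
  ring.
- apply: (pairing_injl P) => w; rewrite ?qE.
  rewrite (cpC b' l) (cpC b l) !(cmC m) (cmC c' c) ?(cmC _ (cp l _)).
  ring.
- apply: (pairing_injr P) => w; rewrite ?qE.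
  rewrite !(cpC l) (cpC b' b) ?(cmC m) ?(cpC _ (cm _ _)).
  ring.
- rewrite (cpair_Tcp P b l) (cpair_Tcp P b' l) (cpC b'). ring.
Qed.

Lemma qmul_linl y : linear (qmul^~ y).
Proof.
move=> k; move: y => [[[a b] c] d] [[[a' b'] c'] d'] [[[l m] n] o].
congr (_, _, _, _); rewrite /= /Tr ?qE ?scale_regE ?scalerDr ?scalerDl ?scalerA.
- ring.
- apply: (pairing_injl P) => w; rewrite ?qE; ring.
- apply: (pairing_injr P) => w; rewrite ?qE; ring.
- ring.
Qed.

Lemma qmul_linr x : linear (qmul x).
Proof.
move=> k; move: x => [[[a b] c] d] [[[a' b'] c'] d'] [[[l m] n] o].
congr (_, _, _, _); rewrite /= /Tr ?qE ?scale_regE.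
- ring.
- apply: (pairing_injl P) => w; rewrite ?qE; ring.
- apply: (pairing_injr P) => w; rewrite ?qE; ring.
- ring.
Qed.

Lemma qstar_lin : linear qstar.
Proof. by move=> k [[[a b] c] d] [[[a' b'] c'] d']. Qed.

End Operators.

(** * Commutation relations among the graded operators *)

Section Commutation.
Variables (K : comPzRingType) (Vp Vm : lmodType K) (T : Vp -> Vm -> K).
Variables (cp : Vp -> Vp -> Vm) (cm : Vm -> Vm -> Vp).
Variable P : cubic_pairing T cp cm.
Local Notation P' := (cubic_pairing_swap P).
Local Notation qE := (cpE P, cpE P', pairingE P).
Let cpC := cpair_cpC P.
Let cmC := cpair_cmC P.

Local Notation quad := (quad Vp Vm).
Local Notation X := (up_op T cp).
Local Notation Y := (down_op T cm).
Local Notation XY := (updown_op T cp cm).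
Local Notation G := (@grade_op K Vp Vm).
Local Notation G' := (@cograde_op K Vp Vm).

Lemma up_op_linr v : linear (X v).
Proof.
move=> k [[[a b] c] d] [[[a' b'] c'] d'].
congr (_, _, _, _); rewrite /= ?qE //.
- by rewrite scalerDl scalerA.
- by rewrite scaler0 addr0.
Qed.

Lemma up_op_linl z : linear (X^~ z).
Proof.
move: z => [[[a b] c] d] k v w.
congr (_, _, _, _); rewrite /= ?qE //.
- by rewrite scalerDr !scalerA mulrC.
- by rewrite scaler0 addr0.
Qed.

Lemma down_op_linr v : linear (Y v).
Proof.
move=> k [[[a b] c] d] [[[a' b'] c'] d'].
congr (_, _, _, _); rewrite /= ?qE //.
- by rewrite scaler0 addr0.
- by rewrite scalerDl scalerA.
Qed.

Lemma down_op_linl z : linear (Y^~ z).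
Proof.
move: z => [[[a b] c] d] k v w.
congr (_, _, _, _); rewrite /= ?qE //.
- by rewrite scaler0 addr0.
- by rewrite scalerDr !scalerA mulrC.
Qed.

(** A consequence of the symmetry of the trilinear form T(u, v \times w) and of the product. *)
Lemma up_up v w z : X v (X w z) = X w (X v z).
Proof.
move: z => [[[a b] c] d]; congr (_, _, _, _); rewrite /= ?qE ?scale0r //.
- exact: (cpair_Tcp P).
- by rewrite cpC.
Qed.

Lemma up_grade v z : X v (G z) = G (X v z) - X v z.
Proof.
move: z => [[[a b] c] d]; congr (_, _, _, _); rewrite /= ?qE.
- ring.
- by rewrite scaleNr add0r.
- by rewrite subrr.
- by rewrite oppr0 addr0.
Qed.

Lemma up_cograde v z : X v (G' z) = G' (X v z) + X v z.
Proof.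
move: z => [[[a b] c] d]; congr (_, _, _, _); rewrite /= ?qE.
- by rewrite addNr.
- by rewrite mulr_natl mulr2n scalerDl.
- by rewrite add0r.
- by rewrite mulr0 addr0.
Qed.

Variable A4 : lin_adjoint_identity T cp cm.

(* The adjoint of [A4], as a linear map in its argument b, for the pairing T. *)
Lemma dual_adjoint_identity a c d y :
  cp a (cm (cp c d) y) + cp c (cm (cp a d) y) + cp d (cm (cp a c) y) =
  T d y *: cp a c + T c y *: cp a d + T a (cp c d) *: y + T a y *: cp c d.
Proof.
apply: (pairing_injr P) => b; rewrite ?qE.
have Tl u v w : T b (cp u (cm (cp v w) y)) = T (cm (cp b u) (cp v w)) y.
  by rewrite (pairing_crosscross P) (cmC _ y) (cpair_Tcm P).
rewrite !Tl.
have := congr1 (T^~ y) (A4 b a c d); rewrite !qE => ->.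
ring.
Qed.

(** The bracket [X_v, [X_b, Y_c]] has degree 2, and it is again some X_p. Only the third coordinate
    needs the adjoint identity. *)
Lemma up_updown v b c z :
  X v (XY b c z) = XY b c (X v z)
    + X (cm c (cp b v) - T b c *: v - T v c *: b) z.
Proof.
move: z => [[[k l] m] n]; congr (_, _, _, _); rewrite /= ?qE.
- rewrite (pairing_crosscross P) (cmC c (cp _ _)) (cpair_Tcm P m) (cmC m).
  rewrite (cpC v b); ring.
- by apply: (pairing_injl P) => w; rewrite ?qE; ring.
- apply: (pairing_injr P) => w; rewrite ?qE.
  rewrite !(cmC c) (cpC (cm _ _) l) (cpC b v) (cpair_Tcp P b v).
  (* Two of the three terms on the left are moved across, so that the first can be eliminated from
     the goal. *)
  have := congr1 (T w) (dual_adjoint_identity v b l c); rewrite !qE.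
  by move=> /(canRL (addrK _))/(canRL (addrK _)) ->; ring.
- ring.
Qed.

(** On the coordinate in [Vp] this is the linearized adjoint identity, on that in [Vm] its dual; the
    outer coordinates only use the symmetry of T(a, b \times c). *)
Lemma up_down_cyclic a b c z :
  XY a (cp b c) z + XY b (cp a c) z + XY c (cp a b) z =
  T a (cp b c) *: (G z - G' z).
Proof.
have Tb : T b (cp a c) = T a (cp b c) by rewrite (cpair_Tcp P).
have Tc : T c (cp a b) = T a (cp b c) by rewrite (cpair_Tcp P) (cpC c).
move: z => [[[k l] m] n]; congr (_, _, _, _); rewrite /= ?qE ?scale_regE ?Tb ?Tc.
- ring.
- apply: (pairing_injl P) => w; rewrite ?qE.
  have := congr1 (T^~ w) (A4 l a b c); rewrite !qE.
  rewrite !(cpC l) !(cmC (cp _ l)).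
  by move=> /(canRL (addrK _))/(canRL (addrK _)) ->; ring.
- apply: (pairing_injr P) => w; rewrite ?qE.
  have := congr1 (T w) (dual_adjoint_identity a b c m); rewrite !qE.
  by move=> /(canRL (addrK _))/(canRL (addrK _)) ->; ring.
- ring.
Qed.
End Commutation.

(** * Derivations of the triple product *)

Section Derivations.
Variables (K : comPzRingType) (Vp Vm : lmodType K) (T : Vp -> Vm -> K).
Variables (cp : Vp -> Vp -> Vm) (cm : Vm -> Vm -> Vp).

(* [D'] acts on the middle variable, which transforms contragrediently. *)
Definition triple_derivation (D D' : quad Vp Vm -> quad Vp Vm) : Prop :=
  forall x y z, D (qtriple T cp cm x y z) =
    qtriple T cp cm (D x) y z + qtriple T cp cm x (D' y) z
    + qtriple T cp cm x y (D z).

Variable P : cubic_pairing T cp cm.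
Local Notation P' := (cubic_pairing_swap P).
Local Notation qE := (cpE P, cpE P', pairingE P).
Let cpC := cpair_cpC P.
Let cmC := cpair_cmC P.

Local Notation quad := (quad Vp Vm).
Local Notation X := (up_op T cp).
Local Notation Y := (down_op T cm).
Local Notation XY := (updown_op T cp cm).
Local Notation G := (@grade_op K Vp Vm).
Local Notation G' := (@cograde_op K Vp Vm).

Lemma updown_op_linl c z : linear (fun b => XY b c z).
Proof.
have [_ YD YN YZ] := linear_rules (down_op_linr P c).
have [_ XD _ XZ] := linear_rules (up_op_linl P z).
have [_ XD' _ XZ'] := linear_rules (up_op_linl P (Y c z)).
move=> k x y; rewrite /updown_op ?(XD, XZ, XD', XZ', YD, YZ).
apply: (quad_sep P) => phi /scalar_rules[_ pD pN pZ]; rewrite !(pD, pN, pZ).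
ring.
Qed.

Lemma updown_op_linm b z : linear (fun c => XY b c z).
Proof.
have [_ XD XN XZ] := linear_rules (up_op_linr P b).
have [_ YD _ YZ] := linear_rules (down_op_linl P z).
have [_ YD' _ YZ'] := linear_rules (down_op_linl P (X b z)).
move=> k x y; rewrite /updown_op ?(YD, YZ, YD', YZ', XD, XZ).
apply: (quad_sep P) => phi /scalar_rules[_ pD pN pZ]; rewrite !(pD, pN, pZ).
ring.
Qed.

(** After [qtripleE], X_v is moved to the right past every operator in V_{x,y} by the commutation
    relations. What remains is a linear relation between operators applied to [z], in which
    [up_down_cyclic] links the commutators to the diagonal operators. *)
Lemma up_op_derivation (A4 : lin_adjoint_identity T cp cm) v :
  triple_derivation (X v) (fun y => - X v y).
Proof.
move=> [[[a b] c] d] [[[a' b'] c'] d'] z.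
have -> : - X v (a', b', c', d') = (- T v c', - (d' *: v), - cp v b', 0).
  by congr (_, _, _, _); rewrite oppr0.
rewrite [X v (a, b, c, d)]/= !(qtripleE P).
have [X0 XD XN XZ] := linear_rules (up_op_linr P v).
(* The count matters: [XD] would also match [X v (XY _ _ _)], as [XY] unfolds
   to a sum. *)
rewrite 5!XD XN 2!XZ !(up_up P v) (up_grade P) (up_cograde P).
rewrite !(up_updown P A4).
have -> q : X v (Y q z) = XY v q z + Y q (X v z) by rewrite /updown_op subrK.
have [Xl0 XlD XlN XlZ] := linear_rules (up_op_linl P z).
have [Yl0 YlD YlN YlZ] := linear_rules (down_op_linl P z).
have XYl t := linear_rules (updown_op_linl t z).
have XYm t := linear_rules (updown_op_linm t z).
have XYlN t u : XY (- u) t z = - XY u t z by case: (XYl t) => _ _ ->.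
have XYlZ k t u : XY (k *: u) t z = k *: XY u t z by case: (XYl t) => _ _ _ ->.
have XYmD t u w : XY t (u + w) z = XY t u z + XY t w z
  by case: (XYm t) => _ -> _ _.
have XYmN t u : XY t (- u) z = - XY t u z by case: (XYm t) => _ _ ->.
have XYmZ k t u : XY t (k *: u) z = k *: XY t u z by case: (XYm t) => _ _ _ ->.
have cyc := up_down_cyclic P A4 v b b' z.
(* The commutator is made opaque, so that the rules for sums cannot match its unfolding. *)
set W := updown_op T cp cm in XYl XYm XYlN XYlZ XYmD XYmN XYmZ cyc *.
clearbody W; clear XYl XYm.
apply: (quad_sep P) => phi /scalar_rules[p0 pD pN pZ].
have {cyc} := congr1 phi cyc.
rewrite ?qE ?(Xl0, XlD, XlN, XlZ, Yl0, YlD, YlN, YlZ) ?scale0r.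
rewrite ?(XYlN, XYlZ, XYmD, XYmN, XYmZ) ?(p0, pD, pN, pZ).
rewrite (cpC b v) (cpC b' v) (cpair_Tcp P b v) (cpair_Tcp P b' v) (cpC b' b).
(* The cyclic relation is solved for the term with [W v (cp b b') z]. The goal is then an identity
   of scalars whose atoms are values of [phi]. *)
rewrite (cmC (cp v b)) => /(canRL (addrK _))/(canRL (addrK _)) ->.
ring.
Qed.
End Derivations.

Section DerivationClosure.
Variables (K : comPzRingType) (Vp Vm : lmodType K) (T : Vp -> Vm -> K).
Variables (cp : Vp -> Vp -> Vm) (cm : Vm -> Vm -> Vp).
Variable P : cubic_pairing T cp cm.
Local Notation P' := (cubic_pairing_swap P).
Local Notation qE := (cpE P, cpE P', pairingE P).
Local Notation tri := (qtriple T cp cm).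
Local Notation deriv := (triple_derivation T cp cm).

Lemma qtriple_lin1 y z : linear (fun x => tri x y z).
Proof.
have [_ lD lN lZ] := linear_rules (qmul_linl P z).
have [_ mD mN mZ] := linear_rules (qmul_linl P (qstar y)).
have [_ rD rN rZ] := linear_rules (qmul_linr P (qmul T cp cm z (qstar y))).
have [_ sD sN sZ] := linear_rules (qmul_linr P z).
have [_ tD tN tZ] := linear_rules (qmul_linl P y).
have [_ uD uN uZ] := linear_rules (@qstar_lin K Vp Vm).
move=> k x x'; rewrite /qtriple mD mZ lD lZ rD rZ uD uZ sD sZ tD tZ.
apply: (quad_sep P) => phi /scalar_rules[_ pD pN pZ].
by rewrite ?(pD, pN, pZ); ring.
Qed.

Lemma qtriple_lin2 x z : linear (fun y => tri x y z).
Proof.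
have [_ lD lN lZ] := linear_rules (qmul_linl P z).
have [_ mD mN mZ] := linear_rules (qmul_linl P x).
have [_ rD rN rZ] := linear_rules (qmul_linr P x).
have [_ sD sN sZ] := linear_rules (qmul_linr P z).
have [_ tD tN tZ] := linear_rules (qmul_linr P (qmul T cp cm z (qstar x))).
have [_ uD uN uZ] := linear_rules (@qstar_lin K Vp Vm).
move=> k y y'; rewrite /qtriple uD uZ rD rZ lD lZ sD sZ mD mZ tD tZ.
apply: (quad_sep P) => phi /scalar_rules[_ pD pN pZ].
by rewrite ?(pD, pN, pZ); ring.
Qed.

Lemma qtriple_lin3 x y : linear (tri x y).
Proof.
have [_ rD rN rZ] := linear_rules (qmul_linr P (qmul T cp cm x (qstar y))).
have [_ lD lN lZ] := linear_rules (qmul_linl P (qstar y)).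
have [_ mD mN mZ] := linear_rules (qmul_linl P x).
have [_ sD sN sZ] := linear_rules (qmul_linl P (qstar x)).
have [_ tD tN tZ] := linear_rules (qmul_linl P y).
move=> k z z'; rewrite /qtriple rD rZ lD lZ mD mZ sD sZ tD tZ.
apply: (quad_sep P) => phi /scalar_rules[_ pD pN pZ].
by rewrite ?(pD, pN, pZ); ring.
Qed.

Lemma derivation_add D1 D1' D2 D2' : deriv D1 D1' -> deriv D2 D2' ->
  deriv (fun z => D1 z + D2 z) (fun z => D1' z + D2' z).
Proof.
move=> d1 d2 x y z; rewrite d1 d2.
have [_ lD _ _] := linear_rules (qtriple_lin1 y z).
have [_ mD _ _] := linear_rules (qtriple_lin2 x z).
have [_ rD _ _] := linear_rules (qtriple_lin3 x y).
rewrite lD mD rD.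
apply: (quad_sep P) => phi /scalar_rules[_ pD pN pZ].
by rewrite ?(pD, pN, pZ); ring.
Qed.

Lemma derivation_scale k D D' : deriv D D' ->
  deriv (fun z => k *: D z) (fun z => k *: D' z).
Proof.
move=> d x y z; rewrite d.
have [_ _ _ lZ] := linear_rules (qtriple_lin1 y z).
have [_ _ _ mZ] := linear_rules (qtriple_lin2 x z).
have [_ _ _ rZ] := linear_rules (qtriple_lin3 x y).
by rewrite lZ mZ rZ !scalerDr.
Qed.

(** Terms where the two operators hit different arguments occur in both composites and cancel, as
    for ordinary derivations. *)
Lemma derivation_commutator D1 D1' D2 D2' : linear D1 -> linear D2 ->
  deriv D1 D1' -> deriv D2 D2' ->
  deriv (fun z => D1 (D2 z) - D2 (D1 z)) (fun z => D1' (D2' z) - D2' (D1' z)).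
Proof.
move=> /linear_rules[_ D1D _ _] /linear_rules[_ D2D _ _].
move=> d1 d2 x y z.
have [_ lD lN _] := linear_rules (qtriple_lin1 y z).
have [_ mD mN _] := linear_rules (qtriple_lin2 x z).
have [_ rD rN _] := linear_rules (qtriple_lin3 x y).
rewrite d1 d2 2!D1D 2!D2D !d1 !d2 lD lN mD mN rD rN.
apply: (quad_sep P) => phi /scalar_rules[_ pD pN pZ].
by rewrite ?(pD, pN, pZ); ring.
Qed.

(** The companion is -V_{y,x} for the x and y with V_{x,y} = [grade_op]. Direct expansion suffices,
    as all operators here are diagonal. *)
Lemma grade_op_derivation :
  deriv (@grade_op K Vp Vm) (fun z => - cograde_op z).
Proof.
move=> [[[a b] c] d] [[[a' b'] c'] d'] [[[k l] m] n].
congr (_, _, _, _); rewrite /= /Tr ?qE ?scale_regE.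
- ring.
- apply: (pairing_injl P) => w; rewrite ?qE ?scale_regE; ring.
- apply: (pairing_injr P) => w; rewrite ?qE ?scale_regE; ring.
- ring.
Qed.

End DerivationClosure.

(** * Exchange of V_+ and V_- *)

Section Swap.
Variables (K : comPzRingType) (Vp Vm : lmodType K) (T : Vp -> Vm -> K).
Variables (cp : Vp -> Vp -> Vm) (cm : Vm -> Vm -> Vp).

Definition qswap (z : quad Vp Vm) : quad Vm Vp :=
  let: (a, b, c, d) := z in (d, c, b, a).

(** [qswap] is an isomorphism of algebras with involution onto the matrix algebra of the exchanged
    pair, hence it respects the triple product. *)
Lemma qtriple_swap x y z :
  qtriple (Tr T) cm cp (qswap x) (qswap y) (qswap z) =
  qswap (qtriple T cp cm x y z).
Proof.
have mulS u v : qmul (Tr T) cm cp (qswap u) (qswap v)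
    = qswap (qmul T cp cm u v).
  move: u v => [[[a b] c] d] [[[a' b'] c'] d'].
  by congr (_, _, _, _); rewrite (addrC (_ *: _)).
have starS u : qstar (qswap u) = qswap (qstar u).
  by move: u => [[[a b] c] d].
have addS u v : qswap u + qswap v = qswap (u + v).
  by move: u v => [[[a b] c] d] [[[a' b'] c'] d'].
have oppS u : - qswap u = qswap (- u) by move: u => [[[a b] c] d].
by rewrite /qtriple !(starS, mulS, oppS, addS).
Qed.
End Swap.

Lemma qswapK (K : comPzRingType) (Vp Vm : lmodType K) :
  cancel (@qswap K Vp Vm) (@qswap K Vm Vp).
Proof. by case=> [[[a b] c] d]. Qed.

Lemma derivation_swap (K : comPzRingType) (Vp Vm : lmodType K)
    (T : Vp -> Vm -> K) (cp : Vp -> Vp -> Vm) (cm : Vm -> Vm -> Vp) D D' :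
  triple_derivation (Tr T) cm cp D D' ->
  triple_derivation T cp cm (fun z => qswap (D (qswap z)))
    (fun z => qswap (D' (qswap z))).
Proof.
move=> d x y z; rewrite -qtriple_swap d.
have E u v w : qtriple T cp cm (qswap u) v w =
   qswap (qtriple (Tr T) cm cp u (qswap v) (qswap w)).
  by rewrite -qtriple_swap !qswapK.
have E2 u v w : qtriple T cp cm v (qswap u) w =
   qswap (qtriple (Tr T) cm cp (qswap v) u (qswap w)).
  by rewrite -qtriple_swap !qswapK.
have E3 u v w : qtriple T cp cm v w (qswap u) =
   qswap (qtriple (Tr T) cm cp (qswap v) (qswap w) u).
  by rewrite -qtriple_swap !qswapK.
rewrite E E2 E3.
move: (qtriple _ _ _ (D _) _ _) (qtriple _ _ _ _ (D' _) _).
move: (qtriple _ _ _ _ _ (D _)).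
by move=> [[[a b] c] e] [[[a' b'] c'] e'] [[[k l] m] n].
Qed.

(** * The structurable identity *)

Section FiveLinear.
Variables (K : comPzRingType) (Vp Vm : lmodType K) (T : Vp -> Vm -> K).
Variables (cp : Vp -> Vp -> Vm) (cm : Vm -> Vm -> Vp).
Variable P : cubic_pairing T cp cm.
Variable A4p : lin_adjoint_identity T cp cm.
Variable A4m : lin_adjoint_identity (Tr T) cm cp.
Local Notation P' := (cubic_pairing_swap P).

Local Notation tri := (qtriple T cp cm).
Local Notation deriv := (triple_derivation T cp cm).
Local Notation X := (up_op T cp).
Local Notation Y := (down_op T cm).
Local Notation XY := (updown_op T cp cm).

Lemma derivation_ext D1 D1' D2 D2' : D1 =1 D2 -> D1' =1 D2' ->
  deriv D1 D1' -> deriv D2 D2'.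
Proof. by move=> e e' d x y z; rewrite -!e -e' d. Qed.

(** Conjugation by [qswap] turns X_u of the exchanged pair into Y_u; this is where the adjoint
    identity on [Vm] enters. *)
Lemma down_op_derivation u : deriv (Y u) (fun z => - Y u z).
Proof.
apply: derivation_ext (derivation_swap (up_op_derivation P' A4m u)) => z.
- by move: z => [[[a b] c] d].
- by move: z => [[[a b] c] d].
Qed.

Lemma cograde_op_derivation : deriv (@cograde_op K Vp Vm) (fun z => - grade_op z).
Proof.
apply: derivation_ext (derivation_swap (grade_op_derivation P')) => z.
- by move: z => [[[a b] c] d].
- by move: z => [[[a b] c] d].
Qed.

Lemma updown_op_derivation v u : deriv (XY v u) (XY v u).
Proof.
have [_ _ XN _] := linear_rules (up_op_linr P v).
have [_ _ YN _] := linear_rules (down_op_linr P u).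
apply: derivation_ext (derivation_commutator P (up_op_linr P v)
  (down_op_linr P u) (up_op_derivation P A4p v) (down_op_derivation u)) => z //.
(* The companions are -X_v and -Y_u, and the signs cancel in their commutator. *)
have -> : XY v u z = - X v (- Y u z) - - Y u (- X v z) by rewrite XN YN !opprK.
by [].
Qed.

(** Exchanging x and y in [qtripleE] fixes the X and Y terms, and interchanges the coefficients of
    the diagonal operators and the two commutators. Hence the companions add up to -V_{y,x}. *)
Lemma qtriple_derivation x y : deriv (tri x y) (fun z => - tri y x z).
Proof.
move: x y => [[[a b] c] d] [[[a' b'] c'] d'].
have dX := up_op_derivation P A4p (a *: b' + a' *: b + cm c c').
have dY := down_op_derivation (d *: c' + d' *: c + cp b b').
have dG := derivation_scale P (a * d' + T b' c) (grade_op_derivation P).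
have dG' := derivation_scale P (d * a' + T b c') cograde_op_derivation.
have dXY := derivation_scale P (-1) (updown_op_derivation b' c).
have dXY' := updown_op_derivation b c'.
apply: derivation_ext (derivation_add P (derivation_add P (derivation_add P
  (derivation_add P (derivation_add P dX dY) dG) dG') dXY) dXY') => z.
- by rewrite (qtripleE P) scaleN1r.
- rewrite (qtripleE P).
  rewrite (addrC (a' *: b)) (cpair_cmC P c') (addrC (d' *: c)) (cpair_cpC P b').
  apply: (quad_sep P) => phi /scalar_rules[p0 pD pN pZ].
  rewrite ?(p0, pD, pN, pZ). ring.
Qed.

Lemma qtriple_structurable x y z w q :
  tri x y (tri z w q) - tri z w (tri x y q) =
  tri (tri x y z) w q - tri z (tri y x w) q.
Proof.
have [_ _ mN _] := linear_rules (qtriple_lin2 P z q).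
by rewrite qtriple_derivation mN addrK.
Qed.
End FiveLinear.

(** * Polarization of symmetric forms when 2 and 3 are regular *)

Section Polarization.
Variables (E : comPzRingType) (W : zmodType).
Hypothesis reg2 : forall x : E, 2 * x = 0 -> x = 0.
Hypothesis reg3 : forall x : E, 3 * x = 0 -> x = 0.

Lemma additive_mulrn (g : W -> E) :
  (forall u v, g (u + v) = g u + g v) -> forall u n, g (u *+ n) = g u *+ n.
Proof.
move=> gD u; elim=> [|n IH]; last by rewrite !mulrS gD IH.
by apply: (addrI (g 0)); rewrite -gD !addr0.
Qed.

Lemma trilinear_polarization (g : W -> W -> W -> E) :
  (forall x y z, g x y z = g y x z) -> (forall x y z, g x y z = g x z y) ->
  (forall x y u v, g (u + v) x y = g u x y + g v x y) ->
  (forall x, g x x x = 0) -> forall u v, g u v v = 0.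
Proof.
move=> s12 s23 D1 g0 u v.
have D2 x y a b : g x (a + b) y = g x a y + g x b y by rewrite !(s12 x) D1.
have D3 x y a b : g x y (a + b) = g x y a + g x y b by rewrite !(s23 x y) D2.
have M1 x y a n : g (a *+ n) x y = g a x y *+ n.
  exact: (additive_mulrn (D1 x y)).
have M2 x y a n : g x (a *+ n) y = g x a y *+ n by rewrite !(s12 x) M1.
have M3 x y a n : g x y (a *+ n) = g x y a *+ n by rewrite !(s23 x y) M2.
(* The expansion of g at u + nv; n = 1, 2 give two equations, from which [g u u v] is eliminated. *)
have e n : n%:R * (3 * g u u v + 3 * n%:R * g u v v) = 0.
  have := g0 (u + v *+ n); rewrite !(D1, D2, D3) !(M1, M2, M3) !g0.
  rewrite !(s12 v u, s23 _ v u) => <-; ring.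
have e2 : g u u v *+ 6 + g u v v *+ 12 = 0 by rewrite -[RHS](e 2%N); ring.
have e1 : g u u v *+ 3 + g u v v *+ 3 = 0 by rewrite -[RHS](e 1%N); ring.
apply/reg2/reg3.
have -> : 3 * (2 * g u v v)
  = (g u u v *+ 6 + g u v v *+ 12) - (g u u v *+ 3 + g u v v *+ 3) *+ 2 by ring.
by rewrite e2 e1 mul0rn subrr.
Qed.

Lemma quadrilinear_polarization (q : W -> W -> W -> W -> E) :
  (forall x y z w, q x y z w = q y x z w) ->
  (forall x y z w, q x y z w = q x z y w) ->
  (forall x y z w, q x y z w = q x y w z) ->
  (forall x y z u v, q (u + v) x y z = q u x y z + q v x y z) ->
  (forall x, q x x x x = 0) -> forall a b c d, q a b c d = 0.
Proof.
move=> s12 s23 s34 D1 q0.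
have D2 x y z a b : q x (a + b) y z = q x a y z + q x b y z.
  by rewrite !(s12 x) D1.
have D3 x y z a b : q x y (a + b) z = q x y a z + q x y b z.
  by rewrite !(s23 x y) D2.
have D4 x y z a b : q x y z (a + b) = q x y z a + q x y z b.
  by rewrite !(s34 x y z) D3.
have M1 x y z a n : q (a *+ n) x y z = q a x y z *+ n.
  exact: (additive_mulrn (D1 x y z)).
have M2 x y z a n : q x (a *+ n) y z = q x a y z *+ n by rewrite !(s12 x) M1.
have M3 x y z a n : q x y (a *+ n) z = q x y a z *+ n by rewrite !(s23 x y) M2.
have M4 x y z a n : q x y z (a *+ n) = q x y z a *+ n by rewrite !(s34 x y z) M3.
have q3 u v : q u v v v = 0.
  have e n : n%:R * (4 * q u u u v + 6 * n%:R * q u u v v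
                     + 4 * n%:R ^+ 2 * q u v v v) = 0.
    have := q0 (u + v *+ n); rewrite !(D1, D2, D3, D4) !(M1, M2, M3, M4) !q0.
    rewrite !(s12 v u, s23 _ v u, s34 _ _ v u) => <-; ring.
  (* The factor 24 is the third finite difference of 4n^3: taking e3 - 3 e2 + 3 e1 removes [A] and
     [B] and leaves 24 [C]. *)
  apply/reg2/reg2/reg2/reg3.
  set A := q u u u v in e; set B := q u u v v in e; set C := q u v v v in e *.
  have e1 : A *+ 4 + B *+ 6 + C *+ 4 = 0 by rewrite -[RHS](e 1%N); ring.
  have e2 : A *+ 8 + B *+ 24 + C *+ 32 = 0 by rewrite -[RHS](e 2%N); ring.
  have e3 : A *+ 12 + B *+ 54 + C *+ 108 = 0 by rewrite -[RHS](e 3%N); ring.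
  have -> : 3 * (2 * (2 * (2 * C))) = (A *+ 12 + B *+ 54 + C *+ 108)
    - (A *+ 8 + B *+ 24 + C *+ 32) *+ 3 + (A *+ 4 + B *+ 6 + C *+ 4) *+ 3.
    by ring.
  by rewrite e1 e2 e3 !mul0rn subr0 addr0.
(* By [q3] the trilinear form [q x] vanishes on the diagonal. *)
have q2 x u v : q x u v v = 0 by apply: (trilinear_polarization (g := q x)).
move=> a b c d; apply: reg2.
by have := q2 a b (c + d); rewrite D3 !D4 !q2 (s34 _ _ d) add0r addr0 => <-; ring.
Qed.
End Polarization.

(** * Derivatives and adjoints of cubic forms *)

Section CubicFormTheory.
Variables (F : fieldType).
Hypothesis char_neq2 : 2%N \notin [pchar F].
Hypothesis char_neq3 : 3%N \notin [pchar F].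
Variables (E : comPzRingType) (iota : {rmorphism F -> E}).

Lemma two_neq0 : 2%:R != 0 :> F.
Proof. by move: char_neq2; rewrite inE. Qed.
Lemma three_neq0 : 3%:R != 0 :> F.
Proof. by move: char_neq3; rewrite inE. Qed.
Lemma six_neq0 : 6%:R != 0 :> F.
Proof. by rewrite (natrM F 2 3) mulf_neq0 ?two_neq0 ?three_neq0. Qed.

Lemma iota_natVK n : n%:R != 0 :> F -> iota n%:R^-1 * n%:R = 1.
Proof. by move=> n0; rewrite -(rmorph_nat iota) -rmorphM mulVf ?rmorph1. Qed.

Lemma regular_nat n : n%:R != 0 :> F -> forall x : E, n%:R * x = 0 -> x = 0.
Proof. by move=> n0 x e; rewrite -[x]mul1r -(iota_natVK n0) -mulrA e mulr0. Qed.

Let reg2 := regular_nat two_neq0.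
Let reg3 := regular_nat three_neq0.

Section OneForm.
Variables (W W' : lmodType E) (T : W -> W' -> E) (N : W -> E).
Variable f : W -> W -> W -> E.
Hypothesis Nf : linearization iota N f.

Lemma linearization_diag x : f x x x = 6%:R * N x.
Proof.
by case: Nf => _ ->; rewrite mulrA (mulrC 6%:R) (iota_natVK six_neq0) mul1r.
Qed.

(** The linearization [g] chosen inside [cubic_deriv] may a priori differ from [f]. The difference
    vanishes on the diagonal, so polarization makes it vanish at (u, v, v). *)
Lemma cubic_derivE u v : cubic_deriv iota N u v = iota 2%:R^-1 * f u v v.
Proof.
rewrite /cubic_deriv.
have /(xgetPex 0)[g [[s12 s23 l1 _ _] gN] ->] :
  exists e, exists2 f, linearization iota N f & e = iota 2%:R^-1 * f u v v.
  by exists (iota 2%:R^-1 * f u v v); exists f.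
congr (_ * _); apply/subr0_eq.
case: Nf => -[t12 t23 k1 _ _] fN.
apply: (trilinear_polarization reg2 reg3 (g := fun x y z => g x y z - f x y z)).
- by move=> x y z; rewrite s12 t12.
- by move=> x y z; rewrite s23 t23.
- move=> x y a b.
  have [_ -> _ _] := scalar_rules (l1 x y).
  have [_ -> _ _] := scalar_rules (k1 x y).
  by ring.
- move=> x; rewrite linearization_diag.
  have -> : g x x x = 6%:R * N x.
    by rewrite gN mulrA (mulrC 6%:R) (iota_natVK six_neq0) mul1r.
  exact: subrr.
Qed.

Hypothesis Tadd : forall u, scalar (T u).
Hypothesis Tnd : forall w, (forall u, T u w = 0) -> w = 0.

Hypothesis Nadj : has_adjoint iota T N.

Lemma pairing_adjoint u v : T u (adjoint iota T N v) = iota 2%:R^-1 * f u v v.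
Proof. by rewrite -(xgetPex 0 (Nadj v)) cubic_derivE. Qed.

(** In f(u, v + w, v + w) the two cross terms agree by symmetry and absorb the factor 1/2. *)
Lemma pairing_adj_prod u v w : T u (adj_prod iota T N v w) = f u v w.
Proof.
have [_ TD TN _] := scalar_rules (Tadd u).
rewrite /adj_prod !(TD, TN) !pairing_adjoint.
case: Nf => -[_ s23 _ l2 l3] _.
have [_ -> _ _] := scalar_rules (l2 u (v + w)).
have [_ f3D _ _] := scalar_rules (l3 u v); rewrite f3D.
have [_ -> _ _] := scalar_rules (l3 u w).
rewrite (s23 u w v).
transitivity (iota 2%:R^-1 * 2%:R * f u v w); first by ring.
by rewrite (iota_natVK two_neq0) mul1r.
Qed.

Lemma adj_prod_diag v : adj_prod iota T N v v = 2%:R *: adjoint iota T N v.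
Proof.
apply/subr0_eq/Tnd => u.
have [_ TD TN TZ] := scalar_rules (Tadd u).
rewrite TD TN TZ pairing_adj_prod pairing_adjoint mulrA (mulrC 2%:R).
by rewrite (iota_natVK two_neq0) mul1r subrr.
Qed.
End OneForm.

(** The hypothesis is the case a = b = c = d: three equal terms on the left, four on the right.
    Paired with [w], the difference of the sides is a symmetric quadrilinear form, which
    polarization kills. *)
Lemma lin_adjoint_identity_of_diag (Vp Vm : lmodType E) (T : Vp -> Vm -> E)
    (cp : Vp -> Vp -> Vm) (cm : Vm -> Vm -> Vp) :
  cubic_pairing T cp cm ->
  (forall v, 3%:R *: cm (cp v v) (cp v v) = (4%:R * T v (cp v v)) *: v) ->
  lin_adjoint_identity T cp cm.
Proof.
move=> P diag a b c d.
have P' := cubic_pairing_swap P.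
have qE := (cpE P, cpE P', pairingE P).
apply/subr0_eq/(cpair_nondeg P).1 => w.
move: a b c d; apply: (quadrilinear_polarization reg2 reg3 (q := fun a b c d =>
  T (cm (cp a b) (cp c d) + cm (cp a c) (cp b d) + cm (cp a d) (cp b c) -
     (T b (cp c d) *: a + T a (cp c d) *: b + T a (cp b d) *: c
      + T a (cp b c) *: d)) w)).
- move=> a b c d; rewrite ?qE (cpair_cpC P b a) (cpair_cmC P (cp b c)).
  by rewrite (cpair_cmC P (cp b d)) !(cpair_Tcp P b a); ring.
- by move=> a b c d; rewrite ?qE (cpair_cpC P c b) (cpair_Tcp P c b); ring.
- by move=> a b c d; rewrite ?qE (cpair_cpC P d c); ring.
- by move=> a b c d d'; rewrite ?qE; ring.
- move=> v; have := congr1 (T^~ w) (diag v); rewrite ?qE => e.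
  by rewrite -(subrr (3%:R * T (cm (cp v v) (cp v v)) w)) {2}e; ring.
Qed.

Section Pair.
Variables (Vp Vm : lmodType E) (T : Vp -> Vm -> E) (Np : Vp -> E) (Nm : Vm -> E).
Hypotheses (T_bilinear : bilinear_pairing T) (T_nondeg : nondegenerate_pairing T).
Hypotheses (Np_cubic : cubic_form iota Np) (Nm_cubic : cubic_form iota Nm).
Hypothesis TN_adjoint : pair_has_adjoint iota T Np Nm.

Local Notation cp := (adj_prod iota T Np).
Local Notation cm := (adj_prod iota (Tr T) Nm).

Lemma adj_prodC (W W' : lmodType E) (S : W -> W' -> E) N u v :
  adj_prod iota S N u v = adj_prod iota S N v u.
Proof. by rewrite /adj_prod (addrC u) -!addrA (addrC (- _)). Qed.

(** The symmetry fields hold because T(u, v \times w) is the symmetric linearization of the cubic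
    form. *)
Lemma pair_cubic_pairing : cubic_pairing T cp cm.
Proof.
case: Np_cubic => fp Nfp; case: Nm_cubic => fm Nfm.
case: T_bilinear => Tl Tr_; case: T_nondeg => ndl ndr.
case: TN_adjoint => adjp adjm.
split=> //.
- exact: adj_prodC.
- exact: adj_prodC.
- move=> u v w; rewrite !(pairing_adj_prod Nfp Tr_ adjp).
  by case: Nfp => -[].
- move=> u v w; have Tm := pairing_adj_prod Nfm Tl adjm; rewrite /Tr in Tm.
  by rewrite !Tm; case: Nfm => -[].
Qed.

Lemma pair_lin_adjoint_identity :
  (forall v, adjoint iota (Tr T) Nm (adjoint iota T Np v) = Np v *: v) ->
  lin_adjoint_identity T cp cm.
Proof.
move=> idp; apply: lin_adjoint_identity_of_diag pair_cubic_pairing _ => v.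
case: Np_cubic => fp Nfp; case: Nm_cubic => fm Nfm.
case: T_bilinear => Tl Tr_; case: T_nondeg => ndl ndr.
case: TN_adjoint => adjp adjm.
rewrite (pairing_adj_prod Nfp Tr_ adjp) (linearization_diag Nfp).
rewrite (adj_prod_diag Nfp Tr_ ndr adjp).
have dm x : cm x x = 2 *: adjoint iota (Tr T) Nm x.
  exact: (adj_prod_diag Nfm Tl ndl adjm).
have P' := cubic_pairing_swap pair_cubic_pairing.
(* Both sides equal 24 N(v) v: the left is 3 (2 v^#) \times (2 v^#) with v^# \times v^# = 2 (v^#)^#,
   the right uses f(v, v, v) = 6 N(v). *)
rewrite (cpZl P') (cpZr P') dm idp !scalerA; congr (_ *: _); ring.
Qed.
End Pair.
End CubicFormTheory.

(** This carries the algebra axioms from [cM] to [cA]: each element of B is an image under [phi], so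
    each law is pulled back to A. *)
Lemma invalg_iso_transfer (F : fieldType) (A B : invalg_ops F) :
  invalg_iso A B -> is_invalg A -> is_invalg B.
Proof.
case=> phi [lin [psi phiK psiK] phiM phi1 phiS].
case=> -[mull mulr] [mul1 mulr1] starl starM starK.
split; [split | split | | |].
- move=> y k u v; rewrite -(psiK y) -(psiK u) -(psiK v).
  by rewrite -lin -!phiM mull lin.
- move=> y k u v; rewrite -(psiK y) -(psiK u) -(psiK v).
  by rewrite -lin -!phiM mulr lin.
- by move=> x; rewrite -(psiK x) -phi1 -phiM mul1.
- by move=> x; rewrite -(psiK x) -phi1 -phiM mulr1.
- move=> k u v; rewrite -(psiK u) -(psiK v).
  by rewrite -lin -!phiS starl lin.
- by move=> x y; rewrite -(psiK x) -(psiK y) -!phiS -!phiM -phiS starM.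
- by move=> x; rewrite -(psiK x) -!phiS starK.
Qed.

(** * Unit, involution and centre of the matrix algebra *)

Section QuadAlgebra.
Variables (K : comPzRingType) (Vp Vm : lmodType K) (T : Vp -> Vm -> K).
Variables (cp : Vp -> Vp -> Vm) (cm : Vm -> Vm -> Vp).
Variable P : cubic_pairing T cp cm.
Local Notation P' := (cubic_pairing_swap P).
Local Notation "x ** y" := (qmul T cp cm x y) (at level 40).
Local Notation one := (cM_one Vp Vm).

Lemma qmul1l x : one ** x = x.
Proof.
move: x => [[[a b] c] d].
rewrite /cM_one /qmul /Tr !(cpE P, cpE P', pairingE P).
by rewrite !(mul1r, scale1r, scaler0, scale0r, addr0, add0r).
Qed.

Lemma qmul1r x : x ** one = x.
Proof.
move: x => [[[a b] c] d].
rewrite /cM_one /qmul /Tr !(cpE P, cpE P', pairingE P).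
by rewrite !(mulr1, scale1r, scaler0, scale0r, addr0, add0r).
Qed.

Lemma qstarM x y : qstar (x ** y) = qstar y ** qstar x.
Proof.
move: x y => [[[a b] c] d] [[[a' b'] c'] d'].
congr (_, _, _, _); rewrite /Tr.
- by rewrite mulrC.
- by rewrite (addrC (_ *: _)) (cpair_cmC P).
- by rewrite (addrC (_ *: _)) (cpair_cpC P).
- by rewrite mulrC.
Qed.

Lemma qstarK : involutive (@qstar K Vp Vm).
Proof. by case=> [[[a b] c] d]. Qed.

Lemma quad_centre (z : quad Vp Vm) :
  (qstar z = z /\ forall x y, [/\ z ** x - x ** z = 0,
     (z ** x) ** y - z ** (x ** y) = 0, (x ** z) ** y - x ** (z ** y) = 0
     & (x ** y) ** z - x ** (y ** z) = 0]) <-> exists k, z = k *: one.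
Proof.
split=> [[starz cz]|[k ->]].
  move: z starz cz => [[[a b] c] d] [da _] cz.
  (* Commuting with the idempotent (1, 0, 0, 0) kills both off-diagonal entries; invariance under
     the involution has already given d = a. *)
  have [/subr0_eq + _ _ _] := cz (1, 0, 0, 0) 0.
  rewrite /qmul /Tr !(cpE P, cpE P', pairingE P).
  rewrite !(scaler0, scale0r, scale1r, add0r, addr0).
  case=> _ <- -> _; exists a.
  by congr (_, _, _, _); rewrite ?scaler0 ?scale_regE ?mulr1.
have lZ y u : (k *: u) ** y = k *: (u ** y).
  by case: (linear_rules (qmul_linl P y)).
have rZ y u : y ** (k *: u) = k *: (y ** u).
  by case: (linear_rules (qmul_linr P y)).
split=> [|x y].
  by case: (linear_rules (@qstar_lin K Vp Vm)) => _ _ _ ->.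
by split; rewrite !(lZ, rZ, qmul1l, qmul1r) subrr.
Qed.
End QuadAlgebra.

(** * The hermitian form and the cubic form over the exchange algebra *)

Section Exchange.
Variables (F : fieldType).
Hypothesis char_neq2 : 2%N \notin [pchar F].
Hypothesis char_neq3 : 3%N \notin [pchar F].
Variables (K : comPzRingType) (iota : {rmorphism F -> K}) (Vp Vm : lmodType K).
Variables (T : Vp -> Vm -> K) (Np : Vp -> K) (Nm : Vm -> K).
Hypotheses (T_bilinear : bilinear_pairing T) (T_nondeg : nondegenerate_pairing T).
Hypotheses (Np_cubic : cubic_form iota Np) (Nm_cubic : cubic_form iota Nm).
Hypothesis TN_adjoint : pair_has_adjoint iota T Np Nm.

Local Notation E := (K * K)%type.
Local Notation iotaE := (iota2 iota : {rmorphism F -> E}).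
Local Notation W := (exch_mod Vp Vm : lmodType E).
Local Notation N := (exch_N Np Nm : W -> E).
Local Notation h := (exch_h T : W -> W -> E).
Local Notation cp := (adj_prod iota T Np).
Local Notation cm := (adj_prod iota (Tr T) Nm).

Definition exch_trilinear (fp : Vp -> Vp -> Vp -> K) (fm : Vm -> Vm -> Vm -> K)
  (x y z : W) : E := (fp x.1 y.1 z.1, fm x.2 y.2 z.2).

Lemma exch_linearization fp fm : linearization iota Np fp ->
  linearization iota Nm fm -> linearization iotaE N (exch_trilinear fp fm).
Proof.
move=> [[p12 p23 p1 p2 p3] pN] [[m12 m23 m1 m2 m3] mN]; split; last first.
  by move=> x; rewrite /exch_N pN mN.
split.
- by move=> x y z; rewrite /exch_trilinear p12 m12.
- by move=> x y z; rewrite /exch_trilinear p23 m23.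
- by move=> y z k u v; rewrite /exch_trilinear p1 m1.
- by move=> y z k u v; rewrite /exch_trilinear p2 m2.
- by move=> y z k u v; rewrite /exch_trilinear p3 m3.
Qed.

Lemma exch_cubic : cubic_form iotaE N.
Proof.
case: Np_cubic => fp Nfp; case: Nm_cubic => fm Nfm.
by exists (exch_trilinear fp fm); apply: exch_linearization.
Qed.

(** The components cross over, since the adjoint of an element of [Vp] lies in [Vm] and
    conversely. *)
Lemma exch_is_adjoint v :
  is_adjoint iotaE h N v (adjoint iota (Tr T) Nm v.2, adjoint iota T Np v.1).
Proof.
move=> u; case: Np_cubic => fp Nfp; case: Nm_cubic => fm Nfm.
case: TN_adjoint => adjp adjm.
rewrite (cubic_derivE char_neq2 char_neq3 (exch_linearization Nfp Nfm)).
have := pairing_adjoint char_neq2 char_neq3 Nfm adjm u.2 v.2.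
have := pairing_adjoint char_neq2 char_neq3 Nfp adjp u.1 v.1.
by rewrite /exch_h /Tr /= => -> ->.
Qed.

Lemma exch_hermitian : hermitian_form (@exchange K) h.
Proof.
have rl w := scalar_rules (T_bilinear.1 w).
have rr u := scalar_rules (T_bilinear.2 u).
have Dl u v w : T (u + v) w = T u w + T v w by case: (rl w).
have Dr u v w : T u (v + w) = T u v + T u w by case: (rr u).
have Zl a u w : T (a *: u) w = a * T u w by case: (rl w).
have Zr a u w : T u (a *: w) = a * T u w by case: (rr u).
by split=> [v u w|u v w|a u v|a u v|u v //];
  rewrite /exch_h /Tr /= ?(Dl, Dr, Zl, Zr).
Qed.

Lemma exch_nondegenerate : nondegenerate_form h.
Proof.
case: T_nondeg => ndl ndr [up um] e; congr (_, _).
- by apply: ndl => w; have [] := e (0, w).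
- by apply: ndr => w; have [] := e (w, 0).
Qed.

Lemma exch_adjoint (v : W) : adjoint iotaE h N v =
  (adjoint iota (Tr T) Nm v.2, adjoint iota T Np v.1).
Proof.
apply: xget_unique; first exact: exch_is_adjoint.
move=> w adjw; apply/subr0_eq/exch_nondegenerate => u.
have [_ hD _ _ _] := exch_hermitian.
apply: (addIr (h u (adjoint iota (Tr T) Nm v.2, adjoint iota T Np v.1))).
by rewrite -hD subrK add0r -adjw exch_is_adjoint.
Qed.

Lemma exch_adj_prod (v w : W) :
  adj_prod iotaE h N v w = (cm v.2 w.2, cp v.1 w.1).
Proof. by rewrite /adj_prod !exch_adjoint. Qed.

Local Notation M := (cM iota T Np Nm).
Local Notation A := (cA iotaE (@exchange K) h N).

Lemma cM_invalg : is_invalg M.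
Proof.
have P := pair_cubic_pairing char_neq2 char_neq3 T_bilinear T_nondeg
  Np_cubic Nm_cubic TN_adjoint.
split; [split | split | | |].
- by move=> y k; apply: (qmul_linl P y (iota k)).
- by move=> x k; apply: (qmul_linr P x (iota k)).
- exact: (qmul1l P).
- exact: (qmul1r P).
- by move=> k; apply: (@qstar_lin K Vp Vm (iota k)).
- exact: (qstarM P).
- exact: (@qstarK K Vp Vm).
Qed.

(** Regrouping the entries is multiplicative: the exchange involution turns b^* v into (b_- v_+, b_+
    v_-), as in the matrix product. *)
Lemma cM_cA_iso : invalg_iso M A.
Proof.
exists (fun x : M => let: (a, b, c, d) := (x : quad Vp Vm) in
  (((a, d), (b, c)) : A)).
split.
- by move=> k [[[a b] c] d] [[[a' b'] c'] d'].
- exists (fun y : A => (y.1.1, y.2.1, y.2.2, y.1.2) : M).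
    by case=> [[[a b] c] d].
  by case=> [[a d] [b c]].
- move=> [[[a b] c] d] [[[a' b'] c'] d'] /=.
  by rewrite exch_adj_prod; congr (_, (_, _)); rewrite /= (addrC (d *: _)).
- by [].
- by case=> [[[a b] c] d].
Qed.
End Exchange.

Theorem corollary7p6 (F : fieldType)
  (char_neq2 : 2%N \notin [pchar F]) (char_neq3 : 3%N \notin [pchar F])
  (K : comPzRingType) (iota : {rmorphism F -> K}) (Vp Vm : lmodType K)
  (T : Vp -> Vm -> K) (Np : Vp -> K) (Nm : Vm -> K)
  (T_bilinear : bilinear_pairing T) (T_nondeg : nondegenerate_pairing T)
  (Np_cubic : cubic_form iota Np) (Nm_cubic : cubic_form iota Nm)
  (TN_adjoint : pair_has_adjoint iota T Np Nm) :
  let E : comPzRingType := (K * K)%type in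
  let iotaE : {rmorphism F -> E} := iota2 iota in
  let W : lmodType E := exch_mod Vp Vm in
  let N : W -> E := exch_N Np Nm in
  let h : W -> W -> E := exch_h T in
  let M := cM iota T Np Nm in
  let A := cA iotaE (@exchange K) h N in
  [/\ (* (a) *)
      [/\ is_left_module (@exch_scale K Vp Vm),
          cubic_form iotaE N,
          hermitian_form (@exchange K) h /\ nondegenerate_form h,
          has_adjoint iotaE h N
        & [/\ is_invalg M, is_invalg A & invalg_iso M A]],
      (* (b) *)
      pair_adjoint_identity iota T Np Nm -> adjoint_identity iotaE h N
    & (* (c) *)
      pair_adjoint_identity iota T Np Nm ->
      structurable M /\
      (forall z : M, in_centre z <-> exists k : K, z = k *: cM_one Vp Vm)].
Proof.
move=> E iotaE W N h M A.
have P := pair_cubic_pairing char_neq2 char_neq3 T_bilinear T_nondeg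
  Np_cubic Nm_cubic TN_adjoint.
split; [split; [| | split | | split] | |].
- split.
  + exact: exch_scaleA.
  + exact: exch_scale1.
  + by move=> a u v; apply: exch_scaleDr.
  + by move=> v a b; apply: exch_scaleDl.
- exact: exch_cubic.
- exact: exch_hermitian.
- exact: exch_nondegenerate.
- by move=> v; eexists; apply: exch_is_adjoint.
- exact: cM_invalg.
- by apply: invalg_iso_transfer; [apply: cM_cA_iso | apply: cM_invalg].
- exact: cM_cA_iso.
- move=> [_ idp idm]; split=> [v|v]; first by eexists; apply: exch_is_adjoint.
  (* Taking the adjoint twice crosses the components twice, so they return to their places. *)
  by rewrite !exch_adjoint //= idp idm; case: v.
- move=> [_ idp idm]; split; last exact: (quad_centre P).
  split; first exact: cM_invalg.
  have A4p : lin_adjoint_identity T (adj_prod iota T Np)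
      (adj_prod iota (Tr T) Nm).
    exact: pair_lin_adjoint_identity.
  have A4m : lin_adjoint_identity (Tr T) (adj_prod iota (Tr T) Nm)
      (adj_prod iota T Np).
    (* The identity on [Vm] is the one on the first module of the exchanged pair, as [Tr (Tr T)] is
       convertible to [T]. *)
    apply: (@pair_lin_adjoint_identity F char_neq2 char_neq3 K iota Vm Vp)
      => //.
    + by case: T_bilinear.
    + by case: T_nondeg.
    + by case: TN_adjoint.
  exact: (qtriple_structurable P A4p A4m).
Qed.
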